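(* For every tree $T$, $p(T) = d(T)$, where $p(T)$ is the pruning number of $T$ and $d(T)$ is the deduction number of $T$.
   Context: Graphs are finite and simple. A leaf is a vertex of degree 1, and a stem is a vertex adjacent to a leaf. The pruning algorithm on a tree $T$: start with $S = \emptyset$ and repeat the following until no vertices remain. For every connected component $C$ of the current graph (initially $T$): if $|V(C)| \leq 2$, add one vertex of $C$ to $S$; otherwise add every leaf of $C$ to $S$. Then delete all leaves, stems and isolated vertices from the current graph. The algorithm returns the set $S$, regarded as a layout on $T$ with one searcher on each vertex of $S$. The pruning number $p(T)$ is the number $|S|$ of searchers in the layout so constructed. The deduction game on a graph $G$: a layout is a placement of searchers on vertices of $G$ (a vertex may receive several searchers). A vertex is occupied in the layout if it contains at least one searcher, and unoccupied otherwise. A vertex is protected if it is occupied in the initial layout or if a searcher has moved there at some point, and unprotected otherwise. A vertex is fireable if the number of searchers on it is greater than or equal to the number of its unprotected neighbours. Initially every searcher is mobile; once a searcher has moved once, it becomes immobile (cannot move again). At each stage, simultaneously, for every fireable vertex $v$ containing mobile searchers, one searcher moves from $v$ to each unprotected neighbour of $v$ (excess searchers stay on $v$; several fireable vertices may send a searcher to the same target). Stages continue until no new searchers move. The layout is successful if at the end all vertices of $G$ are protected. The deduction number $d(G)$ is the minimum number of searchers in a successful layout on $G$. *)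

(* Defs.v *)
From mathcomp Require Import all_boot.

Set Implicit Arguments.
Unset Strict Implicit.
Unset Printing Implicit Defensive.

(* A graph is an adjacency relation e on a finite type T of vertices. *)

Section Graphs.
Variables (T : finType) (e : rel T).

Definition simple_graph : Prop := symmetric e /\ irreflexive e.

Definition acyclic : Prop := forall c : seq T, 2 < size c -> ~~ ucycleb e c.

Definition is_tree : Prop :=
  [/\ simple_graph, 0 < #|T|, forall x y, connect e x y & acyclic].

(* Below, V is the vertex set of the induced subgraph under consideration. *)

Definition induced (V : {set T}) : rel T :=
  [rel x y | [&& x \in V, y \in V & e x y]].

Definition neighbours (V : {set T}) (x : T) : {set T} := [set y in V | e x y].

Definition leaves (V : {set T}) : {set T} :=
  [set x in V | #|neighbours V x| == 1].

Definition stems (V : {set T}) : {set T} :=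
  [set x in V | [exists y in leaves V, e x y]].

Definition isolated (V : {set T}) : {set T} :=
  [set x in V | #|neighbours V x| == 0].

Definition components (V : {set T}) : {set {set T}} :=
  [set [set y in V | connect (induced V) x y] | x in V].

End Graphs.

(* The algorithm may add any vertex of a component with at most two vertices.
   This freedom is represented by a function ch choosing a vertex in every
   nonempty set. Every run is obtained in this way, because a component with
   at most two vertices is deleted entirely as soon as it has been treated, so
   the same set is never treated twice. *)
Definition vertex_choice (T : finType) (ch : {set T} -> T) : Prop :=
  forall C : {set T}, C != set0 -> ch C \in C.

Section Pruning.
Variables (T : finType) (e : rel T) (ch : {set T} -> T).

Definition pruning_selection (V : {set T}) : {set T} :=
  \bigcup_(C in components e V)
     (if #|C| <= 2 then [set ch C] else leaves e V :&: C).

Definition pruning_remove (V : {set T}) : {set T} :=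
  V :\: (leaves e V :|: stems e V :|: isolated e V).

(* A state is the pair of the remaining vertex set and the set S so far. *)
Definition pruning_step (st : {set T} * {set T}) : {set T} * {set T} :=
  (pruning_remove st.1, st.2 :|: pruning_selection st.1).

(* On a tree, a nonempty remaining graph is a forest, so it has a leaf or an
   isolated vertex and each step deletes at least one vertex: #|T| steps reach
   the empty graph, on which a step does nothing. *)
Definition pruning_output : {set T} :=
  (iter #|T| pruning_step (setT, set0)).2.

Definition pruning_number : nat := #|pruning_output|.

End Pruning.

Definition layout (T : finType) := {ffun T -> nat}.

Definition searchers (T : finType) (L : layout T) : nat := \sum_(v : T) L v.

Record game_state (T : finType) := GameState {
  mobile : {ffun T -> nat};
  immobile : {ffun T -> nat};
  protected : {set T}
}.

Section Deduction.
Variables (T : finType) (e : rel T).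

Definition initial_state (L : layout T) : game_state T :=
  GameState L [ffun=> 0] [set v | 0 < L v].

Definition unprotected_nbrs (s : game_state T) (v : T) : {set T} :=
  [set w | e v w & w \notin protected s].

Definition fireable (s : game_state T) (v : T) : bool :=
  #|unprotected_nbrs s v| <= mobile s v + immobile s v.

Definition fires (s : game_state T) (v : T) : bool :=
  (0 < mobile s v) && fireable s v.

(* The vertices sending a searcher to w in the current stage. *)
Definition senders (s : game_state T) (w : T) : {set T} :=
  [set v | fires s v & w \in unprotected_nbrs s v].

(* Searchers only ever move to vertices that were initially unoccupied, so
   mobile and immobile searchers never share a vertex, and the subtraction is
   exact in every state reached from an initial one. *)
Definition stage (s : game_state T) : game_state T :=
  GameState
    [ffun v => if fires s v then mobile s v - #|unprotected_nbrs s v|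
               else mobile s v]
    [ffun w => immobile s w + #|senders s w|]
    (protected s :|: [set w | senders s w != set0]).

(* A stage in which a searcher moves protects a new vertex, and a stage without
   a move leaves the state unchanged, so the game is over after #|T| stages. *)
Definition final_state (L : layout T) : game_state T :=
  iter #|T| stage (initial_state L).

Definition successful (L : layout T) : bool :=
  protected (final_state L) == setT.

(* A layout with k searchers has at most k searchers on each vertex, hence the
   restriction to the finite type of functions into 'I_k.+1; it is lifted by
   deduction_number_attained and deduction_number_min below. *)
Definition solvable_with (k : nat) : bool :=
  [exists f : {ffun T -> 'I_k.+1},
     let L : layout T := [ffun v => val (f v)] in
     successful L && (searchers L == k)].

Lemma solvable_withP (k : nat) :
  reflect (exists2 L : layout T, successful L & searchers L = k)
          (solvable_with k).
Proof.
apply: (iffP existsP) => [[f /andP[sL /eqP cL]]|[L sL cL]].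
  by exists [ffun v => val (f v)].
have le_Lk v : L v < k.+1 by rewrite ltnS -cL /searchers (bigD1 v) //= leq_addr.
exists [ffun v => Ordinal (le_Lk v)] => /=.
have ->: [ffun v => val ([ffun u => Ordinal (le_Lk u)] v)] = L.
  by apply/ffunP=> v; rewrite !ffunE.
by rewrite sL cL eqxx.
Qed.

Lemma solvable_with_some : exists k, solvable_with k.
Proof.
exists (searchers ([ffun=> 1] : layout T)).
apply/solvable_withP; exists [ffun=> 1] => //.
rewrite /successful /final_state; elim: #|T| => [|n IHn] /=.
  by apply/eqP/setP=> v; rewrite !inE ffunE.
by rewrite (eqP IHn) setTU.
Qed.

Definition deduction_number : nat := ex_minn solvable_with_some.

Lemma deduction_number_attained :
  exists2 L : layout T, successful L & searchers L = deduction_number.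
Proof.
by apply/solvable_withP; rewrite /deduction_number; case: ex_minnP.
Qed.

Lemma deduction_number_min (L : layout T) :
  successful L -> deduction_number <= searchers L.
Proof.
move=> sL; rewrite /deduction_number; case: ex_minnP => m _; apply.
by apply/solvable_withP; exists L.
Qed.

End Deduction.

(* Main.v *)
Require Import Defs.
From mathcomp Require Import all_boot.

Set Implicit Arguments.
Unset Strict Implicit.
Unset Printing Implicit Defensive.

(** The theorem holds because the set [S] returned by the pruning algorithm is
    at the same time independent and, as a layout with one searcher per vertex,
    successful.

    An independent set is a lower bound for every successful layout, in any
    graph ([independent_leq_searchers]). A searcher accounts for at most
    one vertex of [S]: if it starts on a vertex of [S], it can only move to a
    vertex outside [S], so it accounts for the vertex where it starts; if it
    starts outside [S], it accounts at most for the vertex to which it moves.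
    Every vertex of [S] ends up protected, so there are at least [#|S|]
    searchers.

    That [S] is independent ([pruning_output_independent]) follows from two
    facts about a round: the selected vertices are pairwise non-adjacent, since
    two adjacent leaves form a whole component, of which one vertex only is
    chosen; and the neighbours of a selected vertex that are still present are
    deleted in the same round, being stems.

    That [S] is successful ([pruning_layout_successful]) holds because the game
    keeps up with the algorithm: after [k] stages all the vertices deleted in
    the first [k] rounds are protected. Indeed a selected vertex has at most one
    neighbour still present, the others being protected by induction, so it can
    fire if it has not yet done so; and every deleted vertex is selected or has
    a selected neighbour. Finally [#|T|] rounds delete every vertex, since a
    nonempty forest has a vertex of degree at most 1 ([forest_low_degree]). *)

(** * Vertices of low degree in forests *)

(** The path is extended at its head by a neighbour other than the second
    vertex; if that neighbour were already on the path, the edge to it would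
    close a cycle. *)
Lemma acyclic_extend_path (T : finType) (e : rel T) (V : {set T}) x p :
    simple_graph e -> acyclic e -> 1 < #|neighbours e V x| ->
    path e x p -> uniq (x :: p) ->
  exists2 z, z \in V & path e z (x :: p) && uniq (z :: x :: p).
Proof.
move=> [sym_e irr_e] acy deg2 xp Uxp.
have [z]: exists z, z \in neighbours e V x :\ head x p.
  apply/set0Pn; rewrite -card_gt0.
  by move: deg2; rewrite (cardsD1 (head x p)); case: (_ \in _) => // /ltnW.
rewrite !inE => /and3P[z_neq zV exz]; exists z => //.
rewrite cons_uniq Uxp andbT /= sym_e exz xp /= inE negb_or.
have -> /=: z != x by apply: contraTneq exz => ->; rewrite irr_e.
apply/negP=> zp; move: xp Uxp z_neq; case/splitPr: zp => p1 p2.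
rewrite -cat_rcons -cat_cons cat_path cat_uniq => /andP[xp1 _] /andP[Up1 _].
case: p1 xp1 Up1 => [|y p1] xp1 Up1; first by rewrite /= eqxx.
move=> _; have := acy (x :: rcons (y :: p1) z).
rewrite /ucycleb Up1 andbT /cycle rcons_path xp1 last_rcons (sym_e z) exz.
by rewrite /= size_rcons => /(_ isT).
Qed.

Lemma forest_low_degree (T : finType) (e : rel T) (V : {set T}) :
    simple_graph e -> acyclic e -> V != set0 ->
  exists2 x, x \in V & #|neighbours e V x| <= 1.
Proof.
move=> sg acy /set0Pn[x0 x0V]; apply/exists_inP; apply: contraT.
rewrite negb_exists_in => /forall_inP deg2.
have long n : exists x p,
    [/\ x \in V, size p = n, path e x p & uniq (x :: p)].
  elim: n => [|n [x [p [xV sz xp Uxp]]]]; first by exists x0, [::].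
  have deg2x : 1 < #|neighbours e V x| by rewrite ltnNge deg2.
  have [z zV /andP[zp Uzp]] := acyclic_extend_path sg acy deg2x xp Uxp.
  by exists z, (x :: p); split=> //=; rewrite sz.
have [x [p [_ sz _ Uxp]]] := long #|T|.
by have := max_card [in x :: p]; rewrite (card_uniqP Uxp) /= sz ltnn.
Qed.

(** * One round of pruning *)

Section Round.
Variables (T : finType) (e : rel T) (ch : {set T} -> T).
Hypotheses (sg : simple_graph e) (chP : vertex_choice ch).
Implicit Types (V C : {set T}) (x y : T).

Let component V x := [set y in V | connect (induced e V) x y].

Lemma induced_connect_sym V : connect_sym (induced e V).
Proof.
apply: sym_connect_sym => x y; rewrite /induced /= (proj1 sg x y).
by rewrite andbCA.
Qed.

Lemma component_refl V x : x \in V -> x \in component V x.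
Proof. by move=> xV; rewrite inE xV connect0. Qed.

Lemma mem_components V x : x \in V -> component V x \in components e V.
Proof. by move=> xV; apply: imset_f. Qed.

Lemma component_eq V C x : C \in components e V -> x \in C -> C = component V x.
Proof.
case/imsetP=> x0 x0V ->; rewrite inE => /andP[xV x0x].
by apply/setP=> y; rewrite !inE (same_connect (@induced_connect_sym V) x0x).
Qed.

Lemma neighbours_component V x y :
  x \in V -> y \in neighbours e V x -> y \in component V x.
Proof.
rewrite !inE => xV /andP[yV exy].
by rewrite yV connect1 //= /induced /= xV yV.
Qed.

Lemma pruning_selectionP V x :
  reflect (x \in V /\ (if #|component V x| <= 2 then x = ch (component V x)
                       else x \in leaves e V))
          (x \in pruning_selection e ch V).
Proof.
apply: (iffP bigcupP) => [[C CV]|[xV xsel]]; last first.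
  exists (component V x); first exact: mem_components.
  case: ifP xsel => _ xsel; first by rewrite inE -xsel.
  by rewrite inE xsel component_refl.
have sCV : C \subset V.
  by case/imsetP: (CV) => z _ ->; apply/subsetP=> y; rewrite inE => /andP[].
have Cn0 : C != set0.
  by case/imsetP: (CV) => z zV ->; apply/set0Pn; exists z; apply: component_refl.
case: ifP => szC; last first.
  rewrite inE => /andP[xL xC]; split; first exact: (subsetP sCV).
  by rewrite -(component_eq CV xC) szC.
rewrite inE => /eqP xch.
have xC : x \in C by rewrite xch; apply: chP.
split; first exact: (subsetP sCV).
by rewrite -(component_eq CV xC) szC.
Qed.

Lemma pruning_selection_sub V : pruning_selection e ch V \subset V.
Proof. by apply/subsetP=> x /pruning_selectionP[]. Qed.

Lemma neighbours_proper_component V x :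
  x \in V -> #|neighbours e V x| < #|component V x|.
Proof.
move=> xV; apply: proper_card; apply/properP; split.
  by apply/subsetP=> y; apply: neighbours_component.
exists x; first exact: component_refl.
by rewrite inE (proj2 sg) andbF.
Qed.

Lemma pruning_selection_degree V x :
  x \in pruning_selection e ch V -> #|neighbours e V x| <= 1.
Proof.
case/pruning_selectionP=> xV; case: ifP => [szC _|_].
  by rewrite -ltnS (leq_trans (neighbours_proper_component xV)).
by rewrite inE => /andP[_ /eqP->].
Qed.

Lemma adjacent_leaves_component V x y :
  x \in leaves e V -> y \in leaves e V -> e x y -> #|component V x| <= 2.
Proof.
move=> xL yL exy; have [sym_e _] := sg.
have only u v w : u \in leaves e V -> v \in V -> e u v ->
    w \in V -> e u w -> w = v.
  rewrite inE => /andP[_ /cards1P[a nbu]] vV euv wV euw.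
  have : v \in neighbours e V u by rewrite inE vV.
  have : w \in neighbours e V u by rewrite inE wV.
  by rewrite nbu !inE => /eqP-> /eqP->.
have xV : x \in V by move: xL; rewrite inE => /andP[].
have yV : y \in V by move: yL; rewrite inE => /andP[].
have closed_xy : closed (induced e V) [in [set x; y]].
  apply: (intro_closed (@induced_connect_sym V)) => u v /and3P[_ vV euv].
  rewrite !inE => /orP[] /eqP def_u; rewrite def_u in euv.
    by rewrite (only _ _ _ xL yV exy vV euv) eqxx orbT.
  by rewrite (only _ _ _ yL xV _ vV euv) ?eqxx // sym_e.
have le2 : #|[set x; y]| <= 2 by rewrite cards2; case: (_ != _).
apply: leq_trans (subset_leq_card _) le2.
apply/subsetP=> z; rewrite inE => /andP[_ xz].
by have := closed_connect closed_xy xz; rewrite !inE eqxx /= => <-.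
Qed.

Lemma pruning_selection_independent V x y :
  x \in pruning_selection e ch V -> y \in pruning_selection e ch V -> ~~ e x y.
Proof.
move=> xS yS; apply/negP=> exy.
have /pruning_selectionP[xV xsel] := xS.
have /pruning_selectionP[yV ysel] := yS.
have yC : y \in component V x by apply: neighbours_component; rewrite // inE yV.
move: xsel ysel; rewrite -(component_eq (mem_components xV) yC).
case: ifP => [_ def_x def_y|szC xL yL].
  by move: exy; rewrite {1}def_x -def_y (proj2 sg).
by rewrite (adjacent_leaves_component xL yL exy) in szC.
Qed.

(** If the component of the leaf is too small for the leaf to be selected, it
    is reduced to the two ends of the edge, one of which is chosen. *)
Lemma leaf_edge_selected V x y :
    x \in V -> y \in leaves e V -> e x y ->
  (x \in pruning_selection e ch V) || (y \in pruning_selection e ch V).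
Proof.
move=> xV yL exy; have [sym_e irr_e] := sg.
have yV : y \in V by move: yL; rewrite inE => /andP[].
have yC : y \in component V x by apply: neighbours_component; rewrite // inE yV.
have xC := component_refl xV.
have [szC|szC] := leqP #|component V x| 2; last first.
  apply/orP; right; apply/pruning_selectionP; split=> //.
  by rewrite -(component_eq (mem_components xV) yC) leqNgt szC.
have neq_xy : x != y by apply: contraTneq exy => ->; rewrite irr_e.
have defC : component V x = [set x; y].
  apply/esym/eqP; rewrite eqEcard cards2 neq_xy szC andbT.
  by apply/subsetP=> z /set2P[] ->.
have: ch (component V x) \in [set x; y].
  by rewrite -defC; apply: chP; apply/set0Pn; exists x.
case/set2P=> [chx|chy]; apply/orP; [left | right].
  by apply/pruning_selectionP; rewrite szC.
apply/pruning_selectionP.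
by rewrite -(component_eq (mem_components xV) yC) szC.
Qed.

Lemma removed_selected_or_adjacent V x :
    x \in V -> x \notin pruning_remove e V ->
    x \notin pruning_selection e ch V ->
  exists2 y, y \in pruning_selection e ch V & e y x.
Proof.
move=> xV; rewrite !inE xV andbT negbK => rmx xnS; have [sym_e irr_e] := sg.
have edge y : y \in V -> e x y -> (x \in leaves e V) || (y \in leaves e V) ->
    exists2 y, y \in pruning_selection e ch V & e y x.
  move=> yV exy xyL; exists y; last by rewrite sym_e.
  case/orP: xyL => [xL|yL].
    have := leaf_edge_selected yV xL.
    by rewrite sym_e exy (negPf xnS) orbF; apply.
  by have := leaf_edge_selected xV yL exy; rewrite (negPf xnS).
case/orP: rmx => [/orP[deg1|/exists_inP[y yL exy]]|].
- have /cards1P[y nbx] := deg1.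
  have: y \in neighbours e V x by rewrite nbx inE.
  by rewrite inE => /andP[yV exy]; apply: (edge y) => //; rewrite inE xV deg1.
- apply: (edge y) => //; last by rewrite yL orbT.
  by move: yL; rewrite inE => /andP[].
(* an isolated vertex is its own component, so it is the chosen vertex *)
rewrite cards_eq0 => /eqP nbx; case/negP: xnS; apply/pruning_selectionP.
have defC : component V x = [set x].
  apply/setP=> z; rewrite !inE; apply/andP/eqP => [[zV]|->]; last first.
    by rewrite connect0.
  case/connectP=> [[_ -> //|u p /= /andP[/and3P[_ uV exu] _] _]].
  by have := in_set0 u; rewrite -nbx inE uV exu.
rewrite defC cards1; split=> //; apply/esym/set1P.
by apply: chP; apply/set0Pn; exists x; rewrite inE.
Qed.

(** A selected vertex with a neighbour left is a leaf, so that the neighbour is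
    a stem. *)
Lemma selected_neighbour_removed V x y :
    x \in pruning_selection e ch V -> e x y -> y \notin pruning_remove e V.
Proof.
move=> xS exy; rewrite inE negb_and negbK orbC -implybE; apply/implyP=> yV.
have xV := subsetP (pruning_selection_sub V) x xS.
have xL : x \in leaves e V.
  rewrite inE xV eqn_leq (pruning_selection_degree xS) card_gt0.
  by apply/set0Pn; exists y; rewrite inE yV.
rewrite !inE yV /=; apply/orP; left; apply/orP; right.
by apply/exists_inP; exists x => //; rewrite (proj1 sg).
Qed.

Lemma pruning_remove_proper V :
  acyclic e -> V != set0 -> pruning_remove e V \proper V.
Proof.
move=> acy Vn0; have [x xV degx] := forest_low_degree sg acy Vn0.
apply/properP; split; first exact: subsetDl.
exists x => //; move: degx; rewrite !inE xV andbT negbK leq_eqVlt.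
by rewrite ltnS leqn0 => /orP[] ->; rewrite ?orbT.
Qed.

(** * The output of the pruning algorithm *)

Let round k := iter k (pruning_step e ch) (setT, set0).

(** Independence alone is not inductive: the set selected so far must moreover
    have no neighbour among the remaining vertices. *)
Lemma round_independent k :
    (forall x y, x \in (round k).2 -> y \in (round k).2 -> ~~ e x y) /\
    (forall x y, x \in (round k).2 -> e x y -> y \notin (round k).1).
Proof.
have [sym_e _] := sg.
elim: k => [|k [indS nbS]]; first by split=> x y; rewrite inE.
rewrite /round iterS -/(round k) /pruning_step /=; set V := (round k).1 in nbS *.
have selV := subsetP (pruning_selection_sub V).
split=> x y; rewrite in_setU => /orP[xS|xS].
- rewrite in_setU => /orP[yS|/selV yV]; first exact: indS.
  by apply/negP=> exy; have := nbS _ _ xS exy; rewrite yV.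
- rewrite in_setU => /orP[yS|yS]; last exact: (pruning_selection_independent xS yS).
  apply/negP=> exy; rewrite sym_e in exy; have := nbS _ _ yS exy.
  by rewrite (selV x xS).
- by move=> exy; rewrite in_setD (negPf (nbS _ _ xS exy)) andbF.
- exact: selected_neighbour_removed.
Qed.

Lemma pruning_output_independent x y :
  x \in pruning_output e ch -> y \in pruning_output e ch -> ~~ e x y.
Proof. exact: (proj1 (round_independent #|T|)). Qed.

Lemma round_selection_sub_output k :
  k < #|T| -> pruning_selection e ch (round k).1 \subset pruning_output e ch.
Proof.
rewrite /pruning_output -/(round #|T|); elim: #|T| => // n IHn.
rewrite ltnS leq_eqVlt {2}/round iterS -/(round n) => /orP[/eqP->|/IHn sub].
  exact: subsetUr.
exact: subset_trans sub (subsetUl _ _).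
Qed.

Lemma round_empty : acyclic e -> (round #|T|).1 = set0.
Proof.
move=> acy; have bound k : #|(round k).1| <= #|T| - k.
  elim: k => [|k IHk]; first by rewrite subn0 max_card.
  rewrite /round iterS -/(round k) subnS /=.
  have [V0|Vn0] := eqVneq (round k).1 set0.
    by rewrite V0 /pruning_remove set0D cards0.
  have := proper_card (pruning_remove_proper acy Vn0).
  by move=> /leq_trans/(_ IHk); case: (_ - _).
by apply/eqP; rewrite -cards_eq0 -leqn0 -(subnn #|T|).
Qed.

End Round.

(** * Independent sets bound the number of searchers from below *)

Section Game.
Variables (T : finType) (e : rel T) (L : layout T).
Implicit Types (k : nat) (v w : T).

Let game k := iter k (stage e) (initial_state L).

Lemma game_protected_succ k : protected (game k) \subset protected (game k.+1).
Proof. exact: subsetUl. Qed.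

Lemma occupied_protected k v : 0 < L v -> v \in protected (game k).
Proof.
move=> Lv; elim: k => [|k IHk]; first by rewrite inE.
exact: subsetP (game_protected_succ k) v IHk.
Qed.

Lemma mobile_leq_layout k v : mobile (game k) v <= L v.
Proof.
elim: k => [|k IHk] //; rewrite /game iterS -/(game k) /= ffunE.
by case: ifP => // _; rewrite (leq_trans (leq_subr _ _)).
Qed.

Lemma occupied_no_immobile k v : 0 < L v -> immobile (game k) v = 0.
Proof.
move=> Lv; elim: k => [|k IHk]; first by rewrite /= ffunE.
rewrite /game iterS -/(game k) /= ffunE IHk; apply/eqP; rewrite cards_eq0.
apply/eqP/setP=> u; rewrite !inE (occupied_protected k Lv).
by rewrite andbF andbF.
Qed.

Lemma fires_enough_mobile k v :
  fires e (game k) v -> #|unprotected_nbrs e (game k) v| <= mobile (game k) v.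
Proof.
case/andP=> mob; rewrite /fireable occupied_no_immobile ?addn0 //.
exact: leq_trans mob (mobile_leq_layout k v).
Qed.

(** The vertices of [S] protected so far plus the searchers outside [S] that
    can still move: a searcher starting in [S] never protects a vertex of [S],
    so each stage lowers the second term by at least as much as it raises the
    first. *)
Lemma independent_potential (S : {set T}) k :
    (forall x y, x \in S -> y \in S -> ~~ e x y) ->
  #|S :&: protected (game k)| + \sum_(v in ~: S) mobile (game k) v
    <= searchers L.
Proof.
move=> indS; elim: k => [|k IHk].
  rewrite /searchers [leqRHS](bigID [in S]) /= leq_add //; last first.
    by rewrite (eq_bigl (fun v => v \notin S)) // => v; rewrite inE.
  rewrite -sum1_card big_mkcond [leqRHS]big_mkcond /=.
  by apply: leq_sum => v _; rewrite !inE; case: (v \in S); case: (L v).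
apply: leq_trans IHk; rewrite /game iterS -/(game k).
set s := game k; set N := unprotected_nbrs e s.
pose spent v := if fires e s v then #|N v| else 0.
have spentP v : mobile (stage e s) v + spent v = mobile s v.
  rewrite /= ffunE /spent; case: ifP => [fv|_]; last by rewrite addn0.
  by rewrite subnK ?fires_enough_mobile.
rewrite -(eq_bigr _ (fun v _ => spentP v)) big_split /= addnCA [leqLHS]addnC.
rewrite leq_add2l setIUr (leq_trans (leq_of_leqif (leq_card_setU _ _))) //.
rewrite leq_add2l; set new := S :&: _.
have sub_new : new \subset \bigcup_(v in ~: S | fires e s v) N v.
  apply/subsetP=> w /setIP[wS]; rewrite inE => /set0Pn[v].
  rewrite inE => /andP[fv wN]; apply/bigcupP; exists v => //.
  rewrite fv andbT inE; apply/negP=> vS.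
  by move: wN (indS v w vS wS); rewrite inE => /andP[->].
apply: leq_trans (subset_leq_card sub_new) _.
rewrite -big_mkcondr /=.
elim/big_rec2: _ => [|v m U _ leUm]; first by rewrite cards0.
by rewrite (leq_trans (leq_of_leqif (leq_card_setU _ _))) // leq_add2l.
Qed.

Lemma independent_leq_searchers (S : {set T}) :
    (forall x y, x \in S -> y \in S -> ~~ e x y) -> successful e L ->
  #|S| <= searchers L.
Proof.
move=> indS /eqP winL; apply: leq_trans (independent_potential #|T| indS).
by rewrite winL setIT leq_addr.
Qed.

(** * The pruning layout wins *)

(** Firing protects the whole neighbourhood of a vertex, and a vertex that has
    not fired keeps its searchers. *)
Lemma mobile_or_nbrs_protected k v :
    0 < L v ->
  0 < mobile (game k) v \/ (forall w, e v w -> w \in protected (game k)).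
Proof.
move=> Lv; elim: k => [|k [mob|nbP]]; [by left| |right]; last first.
  by move=> w /nbP; apply: (subsetP (game_protected_succ k)).
rewrite /game iterS -/(game k) /= ffunE; case: ifP => [fv|_]; last by left.
right=> w evw; rewrite inE; have [//|wnP] := boolP (w \in protected _).
by rewrite inE; apply/set0Pn; exists v; rewrite !inE fv evw wnP.
Qed.

Lemma single_unprotected_protected k v w :
    0 < L v -> #|unprotected_nbrs e (game k) v| <= 1 -> e v w ->
  w \in protected (game k.+1).
Proof.
move=> Lv deg1 evw; have [wP|wnP] := boolP (w \in protected (game k)).
  exact: subsetP (game_protected_succ k) w wP.
have [mob|/(_ w evw)] := mobile_or_nbrs_protected k Lv; last first.
  by rewrite (negPf wnP).
have fv : fires e (game k) v.
  by rewrite /fires mob /fireable (leq_trans deg1) // (leq_trans mob) ?leq_addr.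
rewrite /game iterS -/(game k) !inE; apply/orP; right.
by apply/set0Pn; exists v; rewrite !inE fv evw wnP.
Qed.

End Game.

Definition indicator_layout (T : finType) (S : {set T}) : layout T :=
  [ffun v => (v \in S) : nat].

Lemma searchers_indicator (T : finType) (S : {set T}) :
  searchers (indicator_layout S) = #|S|.
Proof.
rewrite /searchers -sum1_card [RHS]big_mkcond; apply: eq_bigr => v _.
by rewrite ffunE; case: (v \in S).
Qed.

Section PruningLayout.
Variables (T : finType) (e : rel T) (ch : {set T} -> T).
Hypotheses (sg : simple_graph e) (chP : vertex_choice ch).

Let L := indicator_layout (pruning_output e ch).
Let round k := iter k (pruning_step e ch) (setT, set0).
Let game k := iter k (stage e) (initial_state L).

Lemma pruned_protected k x :
  k <= #|T| -> x \notin (round k).1 -> x \in protected (game k).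
Proof.
elim: k x => [|k IHk] x ltkT; first by rewrite inE.
have selL y : y \in pruning_selection e ch (round k).1 -> 0 < L y.
  by move/(subsetP (round_selection_sub_output e ch ltkT)) => yS; rewrite ffunE yS.
have {}IHk y := IHk y (ltnW ltkT).
have [xV|xnV _] := boolP (x \in (round k).1); last first.
  exact: subsetP (game_protected_succ e L k) x (IHk x xnV).
rewrite {1}/round iterS -/(round k) /= => rmx.
have [xS|xnS] := boolP (x \in pruning_selection e ch (round k).1).
  exact: (occupied_protected e k.+1 (selL x xS)).
have [y yS eyx] := removed_selected_or_adjacent sg chP xV rmx xnS.
apply: (single_unprotected_protected (selL y yS) _ eyx).
apply: leq_trans (subset_leq_card _) (pruning_selection_degree sg chP yS).
apply/subsetP=> z; rewrite !inE => /andP[eyz znP]; rewrite eyz andbT.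
by apply: contraR znP; apply: IHk.
Qed.

Lemma pruning_layout_successful : acyclic e -> successful e L.
Proof.
move=> acy; apply/eqP/setP=> x; rewrite inE.
by apply: pruned_protected; rewrite // /round round_empty ?inE.
Qed.

End PruningLayout.

Theorem theorem5p2 (T : finType) (e : rel T) (ch : {set T} -> T) :
  is_tree e -> vertex_choice ch -> pruning_number e ch = deduction_number e.
Proof.
case=> sg _ _ acy chP; apply/eqP; rewrite eqn_leq; apply/andP; split.
  have [L winL <-] := deduction_number_attained e.
  exact: independent_leq_searchers (pruning_output_independent sg chP) winL.
rewrite /pruning_number -searchers_indicator.
exact: deduction_number_min (pruning_layout_successful sg chP acy).
Qed.
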